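(* If $G$ is a countable group, then the number of ends of $G$ is either infinite or at most $2$.
   Context: For a countable group $G$ equipped with a proper left-invariant metric (balls finite, $d(gh_1,gh_2)=d(h_1,h_2)$; any two such metrics are coarsely equivalent via the identity), the number of ends of $G$ is the cardinality of $CF(G)\setminus G$, where for a proper metric space $X$, $CF(X)$ is the compactification induced by all continuous glacially oscillating functions $X\to[0,1]$. A glacial scale on $X$ is a sequence $\mathcal S=\{(K_i,n_i)\}_{i\ge1}$, $K_i$ bounded, $n_i\in\mathbb N$, such that for every bounded $K$ and $r>0$ there is $i$ with $K\subset K_i$, $n_i>r$; an $\mathcal S$-chain is a finite sequence $x_1,\dots,x_n$ with, for each $i\le n-1$, some $m$ with $x_i,x_{i+1}\notin K_m$ and $d(x_i,x_{i+1})\le n_m$; $f$ is glacially oscillating if for every $\epsilon>0$ there is a glacial scale $\mathcal S$ with $|f(x_1)-f(x_n)|<\epsilon$ for all $\mathcal S$-chains. Equivalently, the number of ends of an infinite $G$ is the supremum of $n$ such that $G$ contains $n$ pairwise disjoint infinite almost invariant subsets ($A$ is almost invariant if $A\,\Delta\,(A g)$ is finite for all $g\in G$). *)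

(* Defs.v *)
From Stdlib Require Import Reals List.
Open Scope R_scope.

Record is_group (G : Type) (mul : G -> G -> G) (inv : G -> G) (e : G) : Prop := {
  grp_assoc : forall x y z, mul x (mul y z) = mul (mul x y) z;
  grp_idl : forall x, mul e x = x;
  grp_idr : forall x, mul x e = x;
  grp_invl : forall x, mul (inv x) x = e;
  grp_invr : forall x, mul x (inv x) = e }.

Definition countable (G : Type) : Prop :=
  exists c : G -> nat, forall x y, c x = c y -> x = y.

Definition is_metric {G : Type} (d : G -> G -> R) : Prop :=
  (forall x y, 0 <= d x y) /\ (forall x y, d x y = 0 <-> x = y) /\
  (forall x y, d x y = d y x) /\ (forall x y z, d x z <= d x y + d y z).

Definition proper_metric {G : Type} (d : G -> G -> R) : Prop :=
  forall (x : G) (r : R), exists l : list G, forall y, d x y <= r -> In y l.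

Definition left_invariant {G : Type} (mul : G -> G -> G) (d : G -> G -> R) : Prop :=
  forall g h1 h2, d (mul g h1) (mul g h2) = d h1 h2.

Definition bounded {G : Type} (d : G -> G -> R) (K : G -> Prop) : Prop :=
  exists (x0 : G) (r : R), forall x, K x -> d x0 x <= r.

Definition glacial_scale {G : Type} (d : G -> G -> R)
  (K : nat -> G -> Prop) (n : nat -> nat) : Prop :=
  (forall i, bounded d (K i)) /\
  (forall (K' : G -> Prop) (r : R), bounded d K' -> 0 < r ->
     exists i, (forall x, K' x -> K i x) /\ r < INR (n i)).

Definition S_chain {G : Type} (d : G -> G -> R)
  (K : nat -> G -> Prop) (n : nat -> nat) (x : nat -> G) (len : nat) : Prop :=
  (1 <= len)%nat /\
  forall i, (S i < len)%nat ->
    exists m, ~ K m (x i) /\ ~ K m (x (S i)) /\ d (x i) (x (S i)) <= INR (n m).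

Definition glacially_oscillating {G : Type} (d : G -> G -> R) (f : G -> R) : Prop :=
  forall eps, 0 < eps ->
    exists (K : nat -> G -> Prop) (n : nat -> nat), glacial_scale d K n /\
      forall x len, S_chain d K n x len -> Rabs (f (x 0%nat) - f (x (pred len))) < eps.

(** The family F of (continuous -- automatic, G being discrete) glacially
    oscillating functions G -> [0,1]. *)
Definition CF_family {G : Type} (d : G -> G -> R) (f : G -> R) : Prop :=
  (forall x, 0 <= f x <= 1) /\ glacially_oscillating d f.

(** Points of CF(G): the closure of the image of G in the product [0,1]^F
    under x |-> (f x)_{f in F}.  A point is a function phi on F, extended
    by 0 outside F; closure in the product topology is tested on finitely
    many coordinates at a time. *)
Definition CF_point {G : Type} (d : G -> G -> R) (phi : (G -> R) -> R) : Prop :=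
  (forall f, ~ CF_family d f -> phi f = 0) /\
  forall (l : list (G -> R)) (eps : R), 0 < eps ->
    (forall f, In f l -> CF_family d f) ->
    exists x : G, forall f, In f l -> Rabs (f x - phi f) < eps.

Definition is_image_of_point {G : Type} (d : G -> G -> R) (phi : (G -> R) -> R) : Prop :=
  exists x : G, forall f, CF_family d f -> phi f = f x.

Definition ends_set {G : Type} (d : G -> G -> R) (phi : (G -> R) -> R) : Prop :=
  CF_point d phi /\ ~ is_image_of_point d phi.

Definition set_infinite {T : Type} (A : T -> Prop) : Prop :=
  ~ exists l : list T, forall a, A a -> In a l.

Definition set_card_le2 {T : Type} (A : T -> Prop) : Prop :=
  forall a b c, A a -> A b -> A c -> a = b \/ a = c \/ b = c.

(* Main.v *)
(** Ends are separated by indicators of almost invariant sets, and every infinite almost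
    invariant set carries an end (the limit along an ultrafilter).  Suppose that the set of
    ends is finite.  Left translations permute the ends, so by the pigeonhole principle there
    are elements [h], outside any given finite set, that fix every end; such an [h] moves
    every almost invariant set [A] only by a finite set.  Also [G] is not locally finite:
    otherwise it has infinitely many disjoint infinite almost invariant sets.

    Three ends give disjoint infinite almost invariant sets [A], [B], [C].  If [h] is far
    enough, then [A] and its translate by [h] are nested, properly and with finite difference
    [D].  So [h] has infinite order and [G] is the union of the translates of [D] by powers
    of [h].  Outside [A] everything then lies along the finitely many backward orbits of
    points of [D], which stay at bounded distance from each other; [B] and [C] both contain
    the tail of such an orbit, contradicting that [B] is almost invariant and disjoint
    from [C]. *)
Require Import Defs.
From Stdlib Require Import Reals List Lra Lia Cantor Classical ClassicalEpsilon FunctionalExtensionality.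
From mathcomp Require filter.
Open Scope R_scope.

(** * Finite sets *)

Definition finite {T : Type} (X : T -> Prop) : Prop := exists L : list T, forall x, X x -> In x L.

Lemma finite_sub {T} (X Y : T -> Prop) : (forall x, X x -> Y x) -> finite Y -> finite X.
Proof. intros H [L HL]. exists L. auto. Qed.

Lemma finite_union {T} (X Y : T -> Prop) : finite X -> finite Y -> finite (fun x => X x \/ Y x).
Proof.
  intros [L HL] [M HM]. exists (L ++ M). intros x [Hx | Hx]; apply in_or_app; auto.
Qed.

Lemma finite_bind {T U} (X : T -> Prop) (R : T -> U -> Prop) :
  finite X -> (forall x, X x -> finite (R x)) -> finite (fun y => exists x, X x /\ R x y).
Proof.
  intros [L HL] HR.
  assert (H : forall M : list T, finite (fun y => exists x, In x M /\ X x /\ R x y)).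
  { induction M as [|a M IH].
    - exists nil. intros y [x [[] _]].
    - apply finite_sub with (fun y => (X a /\ R a y) \/ exists x, In x M /\ X x /\ R x y).
      + intros y [x [[<- | Hx] Hr]]; eauto.
      + apply finite_union; [|exact IH].
        destruct (classic (X a)) as [Ha | Ha].
        * apply finite_sub with (R a); auto. intros y [_ Hy]; exact Hy.
        * exists nil. intros y [Hy _]. contradiction. }
  apply finite_sub with (2 := H L). intros y [x [Hx Hr]]. eauto 6.
Qed.

Lemma finite_preimage {T U} (f : T -> U) (X : U -> Prop) :
  (forall x y, f x = f y -> x = y) -> finite X -> finite (fun x => X (f x)).
Proof.
  intros Hf HX.
  apply finite_sub with (fun x => exists u, X u /\ f x = u); [eauto|].
  apply finite_bind; [exact HX|].
  intros u _. destruct (classic (exists x, f x = u)) as [[x Hx] | Hn].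
  - exists (x :: nil). intros y Hy. left. apply Hf. congruence.
  - exists nil. intros y Hy. apply Hn. eauto.
Qed.

Lemma finite_escape {T} (X : T -> Prop) (f : nat -> T) :
  (forall m n, f m = f n -> m = n) -> finite X ->
  exists N, forall n, (N <= n)%nat -> ~ X (f n).
Proof.
  intros Hf HX. destruct (finite_preimage f X Hf HX) as [L HL].
  exists (S (list_max L)). intros n Hn HXn.
  pose proof (proj1 (list_max_le L (list_max L)) (le_n _)) as HM.
  rewrite Forall_forall in HM. specialize (HM n (HL n HXn)). lia.
Qed.

Lemma infinite_fibre {T U} (X : T -> Prop) (f : T -> U) :
  ~ finite X -> finite (fun u => exists x, X x /\ f x = u) ->
  exists u, ~ finite (fun x => X x /\ f x = u).
Proof.
  intros HX Hf. apply NNPP. intros Hn. apply HX.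
  apply finite_sub with
    (fun x => exists u, (exists y, X y /\ f y = u) /\ (X x /\ f x = u)); [eauto 6|].
  apply finite_bind; [exact Hf|].
  intros u _. apply NNPP. intros H. apply Hn. eauto.
Qed.

Lemma eventually_uniform {T} (X : T -> Prop) (P : T -> nat -> Prop) :
  finite X -> (forall x, X x -> exists N, forall n, (N <= n)%nat -> P x n) ->
  exists N, forall x, X x -> forall n, (N <= n)%nat -> P x n.
Proof.
  intros [L HL] HP.
  assert (H : forall M, exists N, forall x, In x M -> X x -> forall n, (N <= n)%nat -> P x n).
  { induction M as [|a M [N IH]].
    - exists 0%nat. intros x [].
    - destruct (classic (X a)) as [Ha | Ha].
      + destruct (HP a Ha) as [N' HN']. exists (N + N')%nat.
        intros x [<- | Hx] HXx n Hn; [apply HN' | apply IH]; auto; lia.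
      + exists N. intros x [<- | Hx] HXx n Hn; [contradiction | auto]. }
  destruct (H L) as [N HN]. exists N. auto.
Qed.

(** Since [X] is infinite, the sets that contain all but finitely many of its points form a proper
    filter; [U] is an ultrafilter above it. The last clause puts [X] and every cofinite set into
    [U]. *)
Lemma ultrafilter_on {T} (X : T -> Prop) :
  ~ finite X ->
  exists U : (T -> Prop) -> Prop,
    (forall P Q : T -> Prop, (forall x, P x -> Q x) -> U P -> U Q) /\
    (forall P Q : T -> Prop, U P -> U Q -> U (fun x => P x /\ Q x)) /\
    (forall P : T -> Prop, U P \/ U (fun x => ~ P x)) /\
    (forall P : T -> Prop, U P -> exists x, P x) /\
    (forall P : T -> Prop, finite (fun x => X x /\ ~ P x) -> U P).
Proof.
  intros HX.
  pose (F := fun P : T -> Prop => finite (fun x => X x /\ ~ P x)).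
  assert (HF : @filter.ProperFilter T F).
  { split.
    - intros H. apply HX. apply finite_sub with (2 := H). intros x Hx. split; [exact Hx|].
      intros [].
    - split.
      + exists nil. intros x [_ Hx]. exfalso. apply Hx. exact I.
      + intros P Q HP HQ. apply finite_sub with (2 := finite_union _ _ HP HQ).
        intros x [Hx HPQ]. destruct (classic (P x)); [right | left]; split; auto.
        intros HQx. apply HPQ. split; assumption.
      + intros P Q HPQ HP. apply finite_sub with (2 := HP). intros x [Hx Hn]. split; auto. }
  destruct (@filter.ultraFilterLemma T F HF) as [U [HU HFU]].
  pose proof (@filter.ultra_proper _ _ HU) as HP. destruct HP as [HU0 [HU1 HU2 HU3]].
  exists U. repeat split.
  - intros P Q HPQ. apply HU3. exact HPQ.
  - intros P Q. apply HU2.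
  - intros P. apply (@filter.in_ultra_setVsetC T U P HU).
  - intros P HUP. apply NNPP. intros Hn. apply HU0. apply HU3 with (2 := HUP).
    intros x Hx. exfalso. eauto.
  - intros P Hfin. apply HFU. exact Hfin.
Qed.

Section Ends.
Context {G : Type} (e : G) (d : G -> G -> R) (Hd : is_metric d) (Hp : proper_metric d).

Lemma dist_sym x y : d x y = d y x.
Proof. apply Hd. Qed.

Lemma dist_triangle x y z : d x z <= d x y + d y z.
Proof. apply Hd. Qed.

Lemma dist_refl x : d x x = 0.
Proof. apply Hd. reflexivity. Qed.

(** * Almost invariant sets *)

Definition frontier (A : G -> Prop) (r : R) (x : G) : Prop :=
  exists y, d x y <= r /\ ~ (A x <-> A y).

(** For a proper left-invariant metric the points within [r] of [x] are the products [x g] with [g]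
    in a finite ball, so this is the usual finiteness of the symmetric difference of [A] and [A g]
    for all [g]. *)
Definition almost_invariant (A : G -> Prop) : Prop := forall r, finite (frontier A r).

Lemma finite_ball x r : finite (fun y => d x y <= r).
Proof. apply Hp. Qed.

Lemma bounded_finite (K : G -> Prop) : Defs.bounded d K -> finite K.
Proof. intros [x0 [r H]]. exact (finite_sub _ _ H (finite_ball x0 r)). Qed.

Lemma finite_nbhd (K : G -> Prop) r : finite K -> finite (fun y => exists x, K x /\ d x y <= r).
Proof. intros HK. apply finite_bind; [exact HK|]. intros x _. apply finite_ball. Qed.

Lemma finite_within (K : G -> Prop) : finite K -> exists r, forall x, K x -> d e x <= r.
Proof.
  intros [L HL].
  assert (H : forall M, exists r, forall x, In x M -> d e x <= r).
  { induction M as [|a M [r IH]].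
    - exists 0. intros x [].
    - exists (Rmax (d e a) r). intros x [<- | Hx]; [apply Rmax_l|].
      apply Rle_trans with r; [auto | apply Rmax_r]. }
  destruct (H L) as [r Hr]. exists r. auto.
Qed.

Lemma finite_diameter (K : G -> Prop) :
  finite K -> exists r, forall x y, K x -> K y -> d x y <= r.
Proof.
  intros HK. destruct (finite_within K HK) as [r Hr]. exists (r + r). intros x y Hx Hy.
  pose proof (dist_triangle x e y). rewrite (dist_sym x e) in H.
  pose proof (Hr x Hx). pose proof (Hr y Hy). lra.
Qed.

Lemma finite_almost_invariant (A : G -> Prop) : finite A -> almost_invariant A.
Proof.
  intros HA r. apply finite_sub with (2 := finite_union _ _ HA (finite_nbhd A r HA)).
  intros x [y [Hxy Hn]]. destruct (classic (A x)) as [Hx | Hx]; [left; exact Hx|].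
  right. exists y. rewrite dist_sym. split; [|exact Hxy]. tauto.
Qed.

Lemma almost_invariant_compl (A : G -> Prop) :
  almost_invariant A -> almost_invariant (fun x => ~ A x).
Proof.
  intros HA r. apply finite_sub with (2 := HA r). intros x [y [Hxy Hn]].
  exists y. tauto.
Qed.

Lemma almost_invariant_inter (A B : G -> Prop) :
  almost_invariant A -> almost_invariant B -> almost_invariant (fun x => A x /\ B x).
Proof.
  intros HA HB r. apply finite_sub with (2 := finite_union _ _ (HA r) (HB r)).
  intros x [y [Hxy Hn]].
  destruct (classic (A x <-> A y)); [right | left]; exists y; tauto.
Qed.

(** * Indicators as glacially oscillating functions *)

Definition ind (A : G -> Prop) (x : G) : R := if excluded_middle_informative (A x) then 1 else 0.

Lemma ind_true (A : G -> Prop) x : A x -> ind A x = 1.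
Proof. unfold ind. destruct excluded_middle_informative; tauto. Qed.

Lemma ind_false (A : G -> Prop) x : ~ A x -> ind A x = 0.
Proof. unfold ind. destruct excluded_middle_informative; tauto. Qed.

Lemma ind_iff (A : G -> Prop) x y : (A x <-> A y) -> ind A x = ind A y.
Proof.
  intros H. destruct (classic (A x)) as [Hx | Hx].
  - rewrite !ind_true; tauto.
  - rewrite !ind_false; tauto.
Qed.

Lemma exists_INR_ge r : exists i, r <= INR i.
Proof.
  destruct (INR_unbounded r) as [i Hi]. exists i. lra.
Qed.

Lemma chain_invariant K n u len (P : G -> Prop) :
  S_chain d K n u len -> P (u 0%nat) ->
  (forall m x y, ~ K m x -> ~ K m y -> d x y <= INR (n m) -> P x -> P y) ->
  P (u (pred len)).
Proof.
  intros [Hlen Hc] H0 Hstep.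
  assert (H : forall i, (i < len)%nat -> P (u i)).
  { induction i as [|i IH]; intros Hi; [exact H0|].
    destruct (Hc i Hi) as [m [H1 [H2 H3]]]. apply (Hstep m (u i)); auto. apply IH. lia. }
  apply H. lia.
Qed.

(** A step of length at most [i] that starts off the frontier at scale [i] does not change
    membership in [A]. With these frontiers put into the bounded sets, [ind A] is constant along
    chains. *)
Lemma CF_ind (A : G -> Prop) : almost_invariant A -> CF_family d (ind A).
Proof.
  intros HA. split.
  { intros x. unfold ind. destruct excluded_middle_informative; lra. }
  intros eps Heps.
  exists (fun i x => d e x <= INR i \/ frontier A (INR i) x), (fun i => i). split; [split|].
  - intros i. destruct (finite_within _ (HA (INR i))) as [r Hr].
    exists e, (Rmax (INR i) r). intros x [Hx | Hx].
    + apply Rle_trans with (1 := Hx). apply Rmax_l.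
    + apply Rle_trans with (1 := Hr x Hx). apply Rmax_r.
  - intros K' r [x0 [r' HK']] Hr.
    destruct (exists_INR_ge (Rmax (d e x0 + r') (r + 1))) as [i Hi]. exists i.
    pose proof (Rmax_l (d e x0 + r') (r + 1)). pose proof (Rmax_r (d e x0 + r') (r + 1)).
    split; [|lra]. intros x Hx. left.
    pose proof (dist_triangle e x0 x). pose proof (HK' x Hx). lra.
  - intros u len Hu.
    rewrite (ind_iff A (u 0%nat) (u (pred len))).
    + rewrite Rminus_diag, Rabs_R0. exact Heps.
    + apply (chain_invariant _ _ u len (fun x => A (u 0%nat) <-> A x) Hu); [tauto|].
      intros m x y Hx _ Hxy HAx.
      assert (A x <-> A y); [|tauto].
      apply NNPP. intros Hnn. apply Hx. right. exists y. auto.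
Qed.

(** * Points of the compactification and almost invariant sets *)

Lemma CF_point_ind phi (A : G -> Prop) :
  CF_point d phi -> almost_invariant A -> phi (ind A) = 0 \/ phi (ind A) = 1.
Proof.
  intros [_ Hphi] HA. apply NNPP. intros Hn.
  assert (H0 : 0 < Rabs (0 - phi (ind A))) by (apply Rabs_pos_lt; lra).
  assert (H1 : 0 < Rabs (1 - phi (ind A))) by (apply Rabs_pos_lt; lra).
  destruct (Hphi (ind A :: nil) (Rmin (Rabs (0 - phi (ind A))) (Rabs (1 - phi (ind A)))))
    as [x Hx].
  - apply Rmin_glb_lt; assumption.
  - intros f [<- | []]. apply CF_ind. exact HA.
  - specialize (Hx _ (or_introl eq_refl)).
    destruct (classic (A x)) as [HAx | HAx].
    + rewrite (ind_true A x HAx) in Hx.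
      pose proof (Rmin_r (Rabs (0 - phi (ind A))) (Rabs (1 - phi (ind A)))). lra.
    + rewrite (ind_false A x HAx) in Hx.
      pose proof (Rmin_l (Rabs (0 - phi (ind A))) (Rabs (1 - phi (ind A)))). lra.
Qed.

(** Indicators take only the values 0 and 1, so an error below 1/2 is no error. Boolean relations
    between almost invariant sets can thus be checked at a single [x]. *)
Lemma CF_point_approx phi (fs : list (G -> R)) (As : list (G -> Prop)) eps :
  CF_point d phi -> 0 < eps ->
  (forall f, In f fs -> CF_family d f) -> (forall A, In A As -> almost_invariant A) ->
  exists x, (forall f, In f fs -> Rabs (f x - phi f) < eps) /\
            (forall A, In A As -> phi (ind A) = ind A x).
Proof.
  intros Hphi Heps Hfs HAs. pose proof Hphi as [_ Happ].
  destruct (Happ (fs ++ map ind As) (Rmin eps (1 / 2))) as [x Hx].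
  - apply Rmin_glb_lt; lra.
  - intros f Hf. apply in_app_or in Hf as [Hf | Hf]; [auto|].
    apply in_map_iff in Hf as [A [<- HA]]. apply CF_ind. auto.
  - pose proof (Rmin_l eps (1 / 2)). pose proof (Rmin_r eps (1 / 2)).
    exists x. split.
    + intros f Hf. specialize (Hx f (in_or_app _ _ _ (or_introl Hf))). lra.
    + intros A HA.
      specialize (Hx (ind A) (in_or_app _ _ _ (or_intror (in_map ind As A HA)))).
      assert (H2 : Rabs (ind A x - phi (ind A)) < 1 / 2) by lra.
      apply Rabs_def2 in H2.
      destruct (CF_point_ind phi A Hphi (HAs A HA)) as [E | E];
        (destruct (classic (A x)) as [HAx | HAx];
          [rewrite (ind_true A x HAx) in * | rewrite (ind_false A x HAx) in *]); lra.
Qed.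

Lemma ind_eq_1 (A : G -> Prop) x : ind A x = 1 -> A x.
Proof. intros H. apply NNPP. intros Hn. rewrite ind_false in H; [lra | exact Hn]. Qed.

Lemma ind_eq_0 (A : G -> Prop) x : ind A x = 0 -> ~ A x.
Proof. intros H Hx. rewrite ind_true in H; [lra | exact Hx]. Qed.

Lemma CF_point_compl phi (A : G -> Prop) :
  CF_point d phi -> almost_invariant A -> phi (ind A) = 0 -> phi (ind (fun x => ~ A x)) = 1.
Proof.
  intros Hphi HA H0.
  destruct (CF_point_approx phi nil (A :: (fun x => ~ A x) :: nil) 1 Hphi Rlt_0_1)
    as [x [_ Hx]].
  - intros f [].
  - intros B [<- | [<- | []]]; [|apply almost_invariant_compl]; exact HA.
  - rewrite (Hx (fun x => ~ A x)) by (simpl; tauto).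
    apply ind_true. apply ind_eq_0. rewrite <- H0. symmetry. apply Hx. simpl; tauto.
Qed.

(** On a finite [A] the point [phi] would concentrate on one [z]; each coordinate is then forced to
    be [f z], so that [phi] is the image of [z]. *)
Lemma end_infinite phi (A : G -> Prop) :
  ends_set d phi -> almost_invariant A -> phi (ind A) = 1 -> ~ finite A.
Proof.
  intros [Hphi Hend] HA H1 [L HL].
  assert (Hsing : forall z, almost_invariant (fun x => x = z)).
  { intros z. apply finite_almost_invariant. exists (z :: nil). intros x ->. left. reflexivity. }
  destruct (CF_point_approx phi nil (A :: map (fun z x => x = z) L) 1 Hphi Rlt_0_1)
    as [z [_ Hz]].
  - intros f [].
  - intros B [<- | HB]; [exact HA|]. apply in_map_iff in HB as [z [<- _]]. apply Hsing.
  - assert (HAz : A z).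
    { apply ind_eq_1. rewrite <- H1. symmetry. apply Hz. left. reflexivity. }
    assert (Hphiz : phi (ind (fun x => x = z)) = 1).
    { rewrite Hz; [apply ind_true; reflexivity|]. right.
      apply (in_map (fun z x => x = z) L z). auto. }
    apply Hend. exists z. intros f Hf. apply NNPP. intros Hn.
    destruct (CF_point_approx phi (f :: nil) ((fun x => x = z) :: nil) (Rabs (f z - phi f)) Hphi)
      as [x [Hx1 Hx2]].
    + apply Rabs_pos_lt. lra.
    + intros g [<- | []]. exact Hf.
    + intros B [<- | []]. apply Hsing.
    + assert (x = z).
      { apply (ind_eq_1 (fun x => x = z)). rewrite <- Hphiz. symmetry. apply Hx2.
        left. reflexivity. }
      subst x. specialize (Hx1 f (or_introl eq_refl)). lra.
Qed.

(* The set of endpoints of [S]-chains starting in [f > c] is almost invariant, and [f]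
   exceeds [c] on it up to the prescribed error. *)
Lemma separate_lt phi psi f :
  CF_point d phi -> CF_point d psi -> CF_family d f -> phi f < psi f ->
  exists A, almost_invariant A /\ phi (ind A) = 0 /\ psi (ind A) = 1.
Proof.
  intros Hphi Hpsi Hf Hlt. pose (eps := (psi f - phi f) / 4).
  assert (Heps : 0 < eps) by (unfold eps; lra).
  destruct (proj2 Hf eps Heps) as [K [n [[HK1 HK2] Hosc]]].
  pose (A := fun x => exists u len, S_chain d K n u len /\ psi f - eps < f (u 0%nat) /\
    u (pred len) = x).
  assert (Hstep : forall m x y, ~ K m x -> ~ K m y -> d x y <= INR (n m) -> A x -> A y).
  { intros m x y Hx Hy Hxy [u [len [[Hlen Hu] [Hf0 Hlast]]]].
    exists (fun i => if Nat.ltb i len then u i else y), (S len). repeat split.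
    - lia.
    - intros i Hi. destruct (Nat.ltb_spec i len) as [H1 | H1]; [|lia].
      destruct (Nat.ltb_spec (S i) len) as [H2 | H2]; [auto|].
      exists m. replace i with (pred len) by lia. rewrite Hlast. auto.
    - destruct (Nat.ltb_spec 0 len); [exact Hf0 | lia].
    - simpl. rewrite Nat.ltb_irrefl. reflexivity. }
  assert (HA : almost_invariant A).
  { intros r.
    destruct (HK2 (fun x => x = e) (Rmax r 1)) as [i [_ Hi]].
    - exists e, 0. intros x ->. rewrite dist_refl. lra.
    - pose proof (Rmax_r r 1). lra.
    - pose proof (Rmax_l r 1).
      pose proof (bounded_finite _ (HK1 i)) as HKi.
      apply finite_sub with (2 := finite_union _ _ HKi (finite_nbhd _ r HKi)).
      intros x [y [Hxy Hn]]. destruct (classic (K i x)) as [Hx | Hx]; [left; exact Hx|].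
      right. exists y. rewrite dist_sym. split; [|exact Hxy].
      apply NNPP. intros Hy. apply Hn.
      split; apply (Hstep i); auto; [|rewrite dist_sym]; lra. }
  exists A. split; [exact HA|].
  split.
  - destruct (CF_point_approx phi (f :: nil) (A :: nil) eps Hphi Heps) as [x [Hx1 Hx2]].
    { intros g [<- | []]. exact Hf. }
    { intros B [<- | []]. exact HA. }
    specialize (Hx1 f (or_introl eq_refl)). apply Rabs_def2 in Hx1.
    rewrite Hx2 by (left; reflexivity). apply ind_false.
    intros [u [len [Hu [Hf0 Hlast]]]]. specialize (Hosc u len Hu).
    rewrite Hlast in Hosc. apply Rabs_def2 in Hosc. unfold eps in *. lra.
  - destruct (CF_point_approx psi (f :: nil) (A :: nil) eps Hpsi Heps) as [x [Hx1 Hx2]].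
    { intros g [<- | []]. exact Hf. }
    { intros B [<- | []]. exact HA. }
    specialize (Hx1 f (or_introl eq_refl)). apply Rabs_def2 in Hx1.
    rewrite Hx2 by (left; reflexivity). apply ind_true.
    exists (fun _ => x), 1%nat. repeat split; [lia | lia | lra].
Qed.

Lemma separate phi psi :
  CF_point d phi -> CF_point d psi -> phi <> psi ->
  exists A, almost_invariant A /\ phi (ind A) = 1 /\ psi (ind A) = 0.
Proof.
  intros Hphi Hpsi Hne.
  assert (Hf : exists f, phi f <> psi f).
  { apply NNPP. intros Hn. apply Hne. apply functional_extensionality. intros f.
    apply NNPP. intros H. eauto. }
  destruct Hf as [f Hf].
  assert (HCF : CF_family d f).
  { apply NNPP. intros Hn. apply Hf. rewrite (proj1 Hphi f Hn), (proj1 Hpsi f Hn). reflexivity. }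
  destruct (Rtotal_order (phi f) (psi f)) as [H | [H | H]]; [|contradiction|].
  - destruct (separate_lt phi psi f Hphi Hpsi HCF H) as [A [HA [H0 H1]]].
    exists (fun x => ~ A x). split; [apply almost_invariant_compl; exact HA|].
    split; [apply CF_point_compl; assumption|].
    destruct (CF_point_approx psi nil (A :: (fun x => ~ A x) :: nil) 1 Hpsi Rlt_0_1)
      as [x [_ Hx]].
    { intros g []. }
    { intros B [<- | [<- | []]]; [|apply almost_invariant_compl]; exact HA. }
    rewrite (Hx (fun x => ~ A x)) by (simpl; tauto). apply ind_false. intros Hn. apply Hn.
    apply ind_eq_1. rewrite <- H1. symmetry. apply Hx. simpl; tauto.
  - destruct (separate_lt psi phi f Hpsi Hphi HCF H) as [A [HA [H0 H1]]]. eauto.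
Qed.

Lemma three_ends_disjoint a b c :
  ends_set d a -> ends_set d b -> ends_set d c -> a <> b -> a <> c -> b <> c ->
  exists A B C, almost_invariant A /\ almost_invariant B /\ almost_invariant C /\
    ~ finite A /\ ~ finite B /\ ~ finite C /\
    forall x, ~ (A x /\ B x) /\ ~ (A x /\ C x) /\ ~ (B x /\ C x).
Proof.
  intros Ha Hb Hc Hab Hac Hbc.
  destruct (separate a b (proj1 Ha) (proj1 Hb) Hab) as [P [HP [Pa Pb]]].
  destruct (separate a c (proj1 Ha) (proj1 Hc) Hac) as [Q [HQ [Qa Qc]]].
  destruct (separate b c (proj1 Hb) (proj1 Hc) Hbc) as [S [HS [Sb Sc]]].
  (* [P] contains the end [a] and not [b], [Q] contains [a] and not [c], [S] contains [b] and not
     [c]; so these three sets carry [a], [b], [c]. *)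
  pose (A := fun x => P x /\ Q x).
  pose (B := fun x => ~ P x /\ S x).
  pose (C := fun x => ~ Q x /\ ~ S x).
  assert (HA : almost_invariant A) by (apply almost_invariant_inter; assumption).
  assert (HB : almost_invariant B)
    by (apply almost_invariant_inter; [apply almost_invariant_compl|]; assumption).
  assert (HC : almost_invariant C)
    by (apply almost_invariant_inter; apply almost_invariant_compl; assumption).
  assert (Hinf : forall (phi : (G -> R) -> R) (X Y Z : G -> Prop), ends_set d phi ->
    almost_invariant X -> almost_invariant Y -> almost_invariant Z ->
    (forall x, phi (ind X) = ind X x -> phi (ind Y) = ind Y x -> Z x) -> ~ finite Z).
  { intros phi X Y Z Hphi HX HY HZ Himp. apply (end_infinite phi Z Hphi HZ).
    destruct (CF_point_approx phi nil (X :: Y :: Z :: nil) 1 (proj1 Hphi) Rlt_0_1)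
      as [x [_ Hx]].
    - intros g [].
    - intros W [<- | [<- | [<- | []]]]; assumption.
    - rewrite (Hx Z) by (simpl; tauto). apply ind_true. apply Himp; apply Hx; simpl; tauto. }
  exists A, B, C. repeat (split; [assumption|]).
  split; [|split; [|split]].
  - apply (Hinf a P Q); auto. intros x H1 H2.
    split; apply ind_eq_1; congruence.
  - apply (Hinf b P S); auto. intros x H1 H2.
    split; [apply ind_eq_0 | apply ind_eq_1]; congruence.
  - apply (Hinf c Q S); auto. intros x H1 H2.
    split; apply ind_eq_0; congruence.
  - unfold A, B, C. intros x. tauto.
Qed.

(** * Ends as limits along ultrafilters *)

(** The limit along an ultrafilter containing [X] and all cofinite sets is not the image of any [z],
    because the complement of [z] gets the value 1. *)
Lemma end_of_infinite (X : G -> Prop) :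
  ~ finite X -> almost_invariant X -> exists phi, ends_set d phi /\ phi (ind X) = 1.
Proof.
  intros HX HXai. destruct (ultrafilter_on X HX) as [U [HU1 [HU2 [HU3 [HU4 HU5]]]]].
  pose (lim := fun (f : G -> R) v => forall eps, 0 < eps -> U (fun x => Rabs (f x - v) < eps)).
  assert (Hlim : forall f, CF_family d f -> exists v, lim f v).
  { intros f [Hf _].
    (* The limit is the supremum of the [t] with [t <= f] on a set of the ultrafilter. *)
    destruct (completeness (fun t => U (fun x => t <= f x))) as [m [Hub Hlub]].
    - exists 1. intros t Ht. destruct (HU4 _ Ht) as [x Hx]. pose proof (Hf x). lra.
    - exists 0. apply HU5. exists nil. intros x [_ Hx]. apply Hx. apply Hf.
    - exists m. intros eps Heps.
      assert (H1 : U (fun x => m - eps < f x)).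
      { apply NNPP. intros Hn.
        assert (m <= m - eps); [|lra]. apply Hlub. intros t Ht.
        destruct (Rle_or_lt t (m - eps)) as [H | H]; [exact H|].
        exfalso. apply Hn. apply HU1 with (2 := Ht). intros x Hx. lra. }
      assert (H2 : U (fun x => f x < m + eps)).
      { destruct (HU3 (fun x => m + eps <= f x)) as [H | H].
        - pose proof (Hub _ H). lra.
        - apply HU1 with (2 := H). intros x Hx. lra. }
      apply HU1 with (2 := HU2 _ _ H1 H2). intros x [H3 H4]. apply Rabs_def1; lra. }
  pose (spec := fun (f : G -> R) v => (CF_family d f -> lim f v) /\ (~ CF_family d f -> v = 0)).
  assert (Hspec : forall f, exists v, spec f v).
  { intros f. destruct (classic (CF_family d f)) as [H | H].
    - destruct (Hlim f H) as [v Hv]. exists v. split; [auto | contradiction].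
    - exists 0. split; [contradiction | auto]. }
  pose (phi := fun f => epsilon (inhabits 0) (spec f)).
  assert (Hphi : forall f, spec f (phi f)).
  { intros f. apply epsilon_spec. apply Hspec. }
  assert (Hpt : CF_point d phi).
  { split; [intros f; apply Hphi|].
    intros l eps Heps Hl.
    assert (H : U (fun x => forall f, In f l -> Rabs (f x - phi f) < eps)).
    { induction l as [|f l IH].
      - apply HU5. exists nil. intros x [_ Hx]. apply Hx. intros f [].
      - assert (Hf : CF_family d f) by (apply Hl; left; reflexivity).
        pose proof (proj1 (Hphi f) Hf eps Heps) as H1.
        assert (H2 : U (fun x => forall g, In g l -> Rabs (g x - phi g) < eps)).
        { apply IH. intros g Hg. apply Hl. right. exact Hg. }
        apply HU1 with (2 := HU2 _ _ H1 H2). intros x [H3 H4] g [<- | Hg]; auto. }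
    destruct (HU4 _ H) as [x Hx]. eauto. }
  assert (Hval : forall A, almost_invariant A -> U A -> phi (ind A) = 1).
  { intros A HA HUA. destruct (CF_point_ind phi A Hpt HA) as [H0 | H1]; [|exact H1].
    pose proof (proj1 (Hphi (ind A)) (CF_ind A HA) 1 Rlt_0_1) as H.
    destruct (HU4 _ (HU2 _ _ H HUA)) as [x [H2 H3]].
    rewrite H0, (ind_true A x H3) in H2. apply Rabs_def2 in H2. lra. }
  exists phi. split; [split|].
  - exact Hpt.
  - intros [z Hz].
    assert (Hsing : almost_invariant (fun x => ~ x = z)).
    { apply almost_invariant_compl, finite_almost_invariant.
      exists (z :: nil). intros x ->. left. reflexivity. }
    pose proof (Hz _ (CF_ind _ Hsing)) as H.
    rewrite (Hval _ Hsing) in H.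
    + symmetry in H. exact (ind_eq_1 _ _ H eq_refl).
    + apply HU5. exists (z :: nil). intros x [_ Hx]. left. symmetry. tauto.
  - apply Hval; [exact HXai|]. apply HU5. exists nil. intros x [Hx Hn]. contradiction.
Qed.

(** An end chosen in [X i] determines [i], since no point has the value 1 on two disjoint almost
    invariant sets. *)
Lemma infinite_ends_of_disjoint (X : nat -> G -> Prop) :
  (forall i, ~ finite (X i)) -> (forall i, almost_invariant (X i)) ->
  (forall i j x, X i x -> X j x -> i = j) -> ~ finite (ends_set d).
Proof.
  intros Hinf Hai Hdisj HE.
  pose (end_in := fun i phi => ends_set d phi /\ phi (ind (X i)) = 1).
  pose (phi := fun i => epsilon (inhabits (fun _ : G -> R => 0)) (end_in i)).
  assert (Hphi : forall i, end_in i (phi i)).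
  { intros i. apply epsilon_spec. apply end_of_infinite; auto. }
  destruct (finite_escape (ends_set d) phi) as [N HN].
  - intros i j Hij. destruct (Hphi i) as [Hi1 Hi2], (Hphi j) as [_ Hj2].
    rewrite <- Hij in Hj2.
    destruct (CF_point_approx (phi i) nil (X i :: X j :: nil) 1 (proj1 Hi1) Rlt_0_1)
      as [x [_ Hx]].
    + intros f [].
    + intros B [<- | [<- | []]]; apply Hai.
    + apply (Hdisj i j x); apply ind_eq_1; rewrite <- Hx; auto; simpl; tauto.
  - exact HE.
  - apply (HN N (le_n N)). apply Hphi.
Qed.

(** * Sets closed at a scale *)

(** These are the unions of connected components of the graph joining points at distance at most
    [r]. *)
Definition closed_at (r : R) (X : G -> Prop) : Prop := forall x y, X x -> d x y <= r -> X y.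

Lemma closed_at_le r r' X : r <= r' -> closed_at r' X -> closed_at r X.
Proof. intros Hr HX x y Hx Hxy. apply (HX x y Hx). lra. Qed.

Lemma closed_at_compl r X : closed_at r X -> closed_at r (fun x => ~ X x).
Proof. intros HX x y Hx Hxy Hy. apply Hx, (HX y x Hy). rewrite dist_sym. exact Hxy. Qed.

Lemma frontier_sym A r x y : d x y <= r -> ~ (A x <-> A y) -> frontier A r x /\ frontier A r y.
Proof.
  intros Hxy Hn. split; [exists y; auto|]. exists x. rewrite dist_sym. split; [exact Hxy | tauto].
Qed.

(** * Translations *)

Context (mul : G -> G -> G) (inv : G -> G) (Hg : is_group G mul inv e)
  (Hl : left_invariant mul d).

Lemma mulKV g x : mul (inv g) (mul g x) = x.
Proof. now rewrite (grp_assoc _ _ _ _ Hg), (grp_invl _ _ _ _ Hg), (grp_idl _ _ _ _ Hg). Qed.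

Lemma mulVK g x : mul g (mul (inv g) x) = x.
Proof. now rewrite (grp_assoc _ _ _ _ Hg), (grp_invr _ _ _ _ Hg), (grp_idl _ _ _ _ Hg). Qed.

Lemma mulI g x y : mul g x = mul g y -> x = y.
Proof. intros H. now rewrite <- (mulKV g x), H, mulKV. Qed.

Lemma mulIr x g h : mul g x = mul h x -> g = h.
Proof.
  intros H. rewrite <- (grp_idr _ _ _ _ Hg g), <- (grp_idr _ _ _ _ Hg h).
  now rewrite <- (grp_invr _ _ _ _ Hg x), !(grp_assoc _ _ _ _ Hg), H.
Qed.

Lemma invI g h : inv g = inv h -> g = h.
Proof. intros H. apply (mulI (inv g)). rewrite H at 2. now rewrite !(grp_invl _ _ _ _ Hg). Qed.

Lemma almost_invariant_translate g A : almost_invariant A -> almost_invariant (fun x => A (mul g x)).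
Proof.
  intros HA r. apply finite_sub with (fun x => frontier A r (mul g x)).
  - intros x [y [Hxy Hn]]. exists (mul g y). rewrite Hl. auto.
  - apply finite_preimage; [apply mulI | apply HA].
Qed.

Lemma CF_translate g f : CF_family d f -> CF_family d (fun x => f (mul g x)).
Proof.
  intros [Hf Hosc]. split; [intros x; apply Hf|].
  intros eps Heps. destruct (Hosc eps Heps) as [K [n [[HK1 HK2] Hc]]].
  exists (fun i x => K i (mul g x)), n. split; [split|].
  - intros i. destruct (HK1 i) as [x0 [r Hr]]. exists (mul (inv g) x0), r.
    intros x Hx. rewrite <- (Hl g), mulVK. auto.
  - intros K' r [x0 [r' HK']] Hr.
    destruct (HK2 (fun y => K' (mul (inv g) y)) r) as [i [Hi1 Hi2]].
    + exists (mul g x0), r'. intros y Hy. rewrite <- (Hl (inv g)), mulKV. auto.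
    + exact Hr.
    + exists i. split; [|exact Hi2]. intros x Hx. apply Hi1. rewrite mulKV. exact Hx.
  - intros u len [Hlen Hu]. apply (Hc (fun i => mul g (u i)) len). split; [exact Hlen|].
    intros i Hi. destruct (Hu i Hi) as [m Hm]. exists m. rewrite Hl. exact Hm.
Qed.

(** Left translation by [g], extended to the compactification: the image of [z] goes to that of
    [mul g z]. *)
Definition act (g : G) (phi : (G -> R) -> R) (f : G -> R) : R := phi (fun x => f (mul g x)).

Lemma act_ends g phi : ends_set d phi -> ends_set d (act g phi).
Proof.
  intros [[Hphi0 Hphi] Him]. split; [split|].
  - intros f Hf. apply Hphi0. intros H. apply Hf. apply (CF_translate (inv g)) in H.
    replace f with (fun x => f (mul g (mul (inv g) x))); [exact H|].
    apply functional_extensionality. intros x. now rewrite mulVK.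
  - intros l eps Heps Hf.
    destruct (Hphi (map (fun f x => f (mul g x)) l) eps Heps) as [x Hx].
    + intros f Hfl. apply in_map_iff in Hfl as [f' [<- Hf']]. apply CF_translate. auto.
    + exists (mul g x). intros f Hfl.
      apply (Hx (fun x => f (mul g x))). apply in_map_iff. exists f. auto.
  - intros [z Hz]. apply Him. exists (mul (inv g) z). intros f Hf.
    rewrite <- (Hz (fun x => f (mul (inv g) x)) (CF_translate (inv g) f Hf)). unfold act.
    f_equal. apply functional_extensionality. intros x. now rewrite mulKV.
Qed.

(** * Elements fixing every end, and local finiteness *)

(** If [g] and [g0] act alike on every end, then [mul (inv g0) g] fixes every end. Infinitely many
    [g] are available, so this product can avoid [E]. *)
Lemma exists_fixing_ends (E : G -> Prop) :
  ~ finite (fun _ : G => True) -> finite (ends_set d) -> finite E ->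
  exists h, ~ E h /\ forall phi, ends_set d phi -> act h phi = phi.
Proof.
  intros HG [L HL] HE.
  (* For each end in [l] the infinite set is shrunk to an infinite fibre of [g |-> act g phi], whose
     values are among the finitely many ends. *)
  assert (H : forall l : list ((G -> R) -> R), exists S : G -> Prop, ~ finite S /\
    forall phi, In phi l -> ends_set d phi -> forall g g', S g -> S g' -> act g phi = act g' phi).
  { induction l as [|phi l [S [HS IH]]].
    - exists (fun _ => True). split; [exact HG|]. intros phi [].
    - destruct (classic (ends_set d phi)) as [Hphi | Hphi].
      + destruct (infinite_fibre S (fun g => act g phi) HS) as [psi Hpsi].
        * exists L. intros psi [g [_ <-]]. apply HL, act_ends, Hphi.
        * exists (fun g => S g /\ act g phi = psi). split; [exact Hpsi|].
          intros chi [<- | Hchi] Hend g g' [Hg1 Hg2] [Hg1' Hg2']; [congruence | auto].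
      + exists S. split; [exact HS|]. intros chi [<- | Hchi] Hend; [contradiction | auto]. }
  destruct (H L) as [S [HS Hact]].
  assert (H0 : exists g0, S g0).
  { apply NNPP. intros Hn. apply HS. exists nil. intros g HSg. apply Hn. eauto. }
  destruct H0 as [g0 Hg0].
  assert (H1 : exists g, S g /\ ~ E (mul (inv g0) g)).
  { apply NNPP. intros Hn. apply HS.
    apply finite_sub with (fun g => E (mul (inv g0) g)).
    - intros g HSg. apply NNPP. intros HEg. eauto.
    - apply finite_preimage; [apply mulI | exact HE]. }
  destruct H1 as [g [HSg HEg]]. exists (mul (inv g0) g). split; [exact HEg|].
  intros phi Hphi. apply functional_extensionality. intros f.
  pose proof (equal_f (Hact phi (HL phi Hphi) Hphi g g0 HSg Hg0) (fun x => f (mul (inv g0) x)))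
    as Heq.
  unfold act in *.
  replace (fun x => f (mul (mul (inv g0) g) x)) with (fun x => f (mul (inv g0) (mul g x))).
  - rewrite Heq. f_equal. apply functional_extensionality. intros x. now rewrite mulKV.
  - apply functional_extensionality. intros x. now rewrite (grp_assoc _ _ _ _ Hg).
Qed.

(** If [h] took infinitely many points of [B] out of [B], an end would live on them. It lies in [B]
    and, being fixed by [h], also in the translate that these points avoid. *)
Lemma fixing_ends_moves_finite h A :
  (forall phi, ends_set d phi -> act h phi = phi) -> almost_invariant A ->
  finite (fun x => ~ (A x <-> A (mul h x))).
Proof.
  intros Hh.
  assert (H : forall B, almost_invariant B -> finite (fun x => B x /\ ~ B (mul h x))).
  { intros B HB. apply NNPP. intros Hinf.
    assert (HBh : almost_invariant (fun x => B (mul h x)))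
      by (apply almost_invariant_translate; exact HB).
    assert (HX : almost_invariant (fun x => B x /\ ~ B (mul h x)))
      by (apply almost_invariant_inter; [|apply almost_invariant_compl]; assumption).
    destruct (end_of_infinite _ Hinf HX) as [phi [Hphi H1]].
    pose proof (equal_f (Hh phi Hphi) (ind B)) as Heq.
    destruct (CF_point_approx phi nil
      (B :: (fun x => B (mul h x)) :: (fun x => B x /\ ~ B (mul h x)) :: nil) 1
      (proj1 Hphi) Rlt_0_1) as [x [_ Hx]].
    - intros f [].
    - intros C [<- | [<- | [<- | []]]]; assumption.
    - rewrite (Hx (fun x => B x /\ ~ B (mul h x))) in H1 by (simpl; tauto).
      apply ind_eq_1 in H1 as [HBx HnBx]. apply HnBx.
      apply (ind_eq_1 (fun x => B (mul h x)) x). rewrite <- Hx by (simpl; tauto).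
      (* The indicator of the translate is convertible to the translate of the indicator. *)
      change (act h phi (ind B) = 1). rewrite Heq, (Hx B) by (simpl; tauto).
      apply ind_true. exact HBx. }
  intros HA.
  apply finite_sub with
    (2 := finite_union _ _ (H A HA) (H _ (almost_invariant_compl A HA))).
  intros x Hx. tauto.
Qed.

Lemma moves_finite_inv h A :
  finite (fun x => ~ (A x <-> A (mul h x))) -> finite (fun x => ~ (A x <-> A (mul (inv h) x))).
Proof.
  intros H.
  apply finite_sub with (2 := finite_preimage (mul (inv h)) _ (mulI (inv h)) H).
  intros x Hx. rewrite mulVK. tauto.
Qed.

(* If [G] is locally finite, finite sets [Y k] that are closed at scale [k] can be taken
   pairwise disjoint, and the union of any subfamily is almost invariant; the first
   coordinate of the Cantor pairing splits the family into infinitely many infinite ones. *)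
Lemma not_locally_finite :
  ~ finite (fun _ : G => True) -> finite (ends_set d) ->
  exists r0, forall X, closed_at r0 X -> (exists x, X x) -> ~ finite X.
Proof.
  intros HG HE. apply NNPP. intros Hlf.
  pose (spec := fun (k : nat) (V Y : G -> Prop) =>
    closed_at (INR k) Y /\ finite Y /\ (exists y, Y y) /\ forall y, Y y -> ~ V y).
  assert (Hex : forall k V, finite V -> exists Y, spec k V Y).
  { intros k V HV.
    assert (HX : exists X, closed_at (INR k) X /\ (exists x, X x) /\ finite X).
    { apply NNPP. intros Hn. apply Hlf. exists (INR k). intros X H1 H2 H3. eauto. }
    destruct HX as [X [HX1 [[x Hx] HX2]]].
    (* Only finitely many [g] carry a point of [X] into [V], so some translate of [X] misses [V]. *)
    assert (Hg' : exists g, ~ exists y, X y /\ V (mul g y)).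
    { apply NNPP. intros Hn. apply HG.
      apply finite_sub with (fun g => exists y, X y /\ V (mul g y)).
      - intros g _. apply NNPP. eauto.
      - apply finite_bind; [exact HX2|]. intros y _.
        apply (finite_preimage (fun g => mul g y)); [apply mulIr | exact HV]. }
    destruct Hg' as [g Hgn].
    exists (fun y => X (mul (inv g) y)). split; [|split; [|split]].
    - intros y z Hy Hyz. apply (HX1 _ _ Hy). now rewrite Hl.
    - apply finite_preimage; [apply mulI | exact HX2].
    - exists (mul g x). now rewrite mulKV.
    - intros y Hy HVy. apply Hgn. exists (mul (inv g) y). now rewrite mulVK. }
  pose (next := fun k V => epsilon (inhabits (fun _ : G => False)) (spec k V)).
  (* [V k] collects the sets chosen before stage [k], which the next one has to avoid. *)
  pose (V := fix V (k : nat) : G -> Prop :=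
    match k with
    | O => fun _ => False
    | S k => fun x => V k x \/ next k (V k) x
    end).
  pose (Y := fun k => next k (V k)).
  assert (HV : forall k, finite (V k) /\ spec k (V k) (Y k)).
  { induction k as [|k [IH1 IH2]].
    - assert (H0 : finite (V 0%nat)) by (exists nil; intros x []).
      split; [exact H0|]. apply epsilon_spec, Hex, H0.
    - assert (H0 : finite (V (S k))) by (apply finite_union; [exact IH1 | apply IH2]).
      split; [exact H0|]. apply epsilon_spec, Hex, H0. }
  assert (HYV : forall j k x, (j < k)%nat -> Y j x -> V k x).
  { intros j k x Hjk Hx. induction k as [|k IH]; [lia|].
    destruct (Nat.eq_dec j k) as [-> | Hne]; [right; exact Hx | left; apply IH; lia]. }
  assert (HYdisj : forall j k x, Y j x -> Y k x -> j = k).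
  { intros j k x Hj Hk. destruct (HV j) as [_ [_ [_ [_ Hdj]]]], (HV k) as [_ [_ [_ [_ Hdk]]]].
    destruct (Nat.lt_trichotomy j k) as [H | [H | H]]; [exfalso | exact H | exfalso].
    - exact (Hdk x Hk (HYV j k x H Hj)).
    - exact (Hdj x Hj (HYV k j x H Hk)). }
  apply (infinite_ends_of_disjoint (fun i x => exists k, fst (Cantor.of_nat k) = i /\ Y k x));
    [| | | exact HE].
  - intros i Hfin.
    pose (y := fun j => epsilon (inhabits e) (Y (Cantor.to_nat (i, j)))).
    assert (Hy : forall j, Y (Cantor.to_nat (i, j)) (y j)).
    { intros j. apply epsilon_spec. destruct (HV (Cantor.to_nat (i, j))) as [_ H]. apply H. }
    assert (Hyinj : forall m n, y m = y n -> m = n).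
    { intros m n Hmn. pose proof (Hy m) as Hm. rewrite Hmn in Hm.
      pose proof (HYdisj _ _ _ Hm (Hy n)) as H. apply Cantor.to_nat_inj in H. congruence. }
    destruct (finite_escape _ y Hyinj Hfin) as [N HN].
    apply (HN N (le_n N)). exists (Cantor.to_nat (i, N)).
    rewrite Cantor.cancel_of_to. auto.
  (* For [k >= N] the set [Y k] is closed at scale [r], so the frontier at that scale lies in the
     finite set [V N] and its neighbourhood. *)
  - intros i r. destruct (exists_INR_ge r) as [N HN].
    destruct (HV N) as [HVN _].
    assert (H : forall x z, d x z <= r -> (exists k, fst (Cantor.of_nat k) = i /\ Y k x) ->
      ~ (exists k, fst (Cantor.of_nat k) = i /\ Y k z) -> V N x).
    { intros x z Hxz [k [Hk Hx]] Hz.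
      destruct (Nat.le_gt_cases N k) as [HNk | HNk]; [|exact (HYV k N x HNk Hx)].
      exfalso. apply Hz. exists k. split; [exact Hk|].
      destruct (HV k) as [_ [Hcl _]]. apply (Hcl x z Hx).
      apply le_INR in HNk. lra. }
    apply finite_sub with (2 := finite_union _ _ HVN (finite_nbhd _ r HVN)).
    intros x [z [Hxz Hn]].
    destruct (classic (exists k, fst (Cantor.of_nat k) = i /\ Y k x)) as [Hx | Hx].
    + left. apply (H x z Hxz Hx). tauto.
    + right. exists z. rewrite dist_sym. split; [|exact Hxz].
      apply (H z x); [rewrite dist_sym; exact Hxz | tauto | exact Hx].
  - intros i j x [k [<- Hk]] [k' [<- Hk']]. now rewrite (HYdisj k k' x Hk Hk').
Qed.

(** Otherwise each scale from [r0] on has a closed set finitely close to [A]. Any of them differs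
    from the one at [r0] by a finite set closed at [r0], hence not at all. So one [X] is closed at
    all scales, and is empty or all of [G]. *)
Lemma exists_scale_not_closed A r0 :
  ~ finite A -> ~ finite (fun x => ~ A x) ->
  (forall X, closed_at r0 X -> (exists x, X x) -> ~ finite X) ->
  exists r, r0 <= r /\ forall X, closed_at r X -> ~ finite (fun x => ~ (A x <-> X x)).
Proof.
  intros HA HcA Hr0. apply NNPP. intros Hn.
  assert (Hcl : forall r, r0 <= r -> exists X, closed_at r X /\ finite (fun x => ~ (A x <-> X x))).
  { intros r Hr. apply NNPP. intros H. apply Hn. exists r. split; [exact Hr|].
    intros X H1 H2. eauto. }
  destruct (Hcl r0 (Rle_refl r0)) as [X [HX1 HX2]].
  assert (HX : forall r, r0 <= r -> closed_at r X).
  { intros r Hr. destruct (Hcl r Hr) as [Y [HY1 HY2]].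
    assert (HXY : forall x, X x <-> Y x).
    { intros x. apply NNPP. intros Hx.
      apply (Hr0 (fun x => ~ (X x <-> Y x))).
      - pose proof (closed_at_le _ _ _ Hr HY1) as HY0.
        pose proof (closed_at_compl _ _ HX1) as HX1'.
        pose proof (closed_at_compl _ _ HY0) as HY0'.
        intros y z Hy Hyz.
        specialize (HX1 y z). specialize (HY0 y z).
        specialize (HX1' y z). specialize (HY0' y z). simpl in *. tauto.
      - eauto.
      - apply finite_sub with (2 := finite_union _ _ HX2 HY2). intros y Hy. tauto. }
    intros x y Hx Hxy. apply HXY. apply HXY in Hx. exact (HY1 x y Hx Hxy). }
  destruct (classic (exists x, X x)) as [[x Hx] | Hempty].
  - apply HcA. apply finite_sub with (2 := HX2). intros y Hy H.
    apply Hy, H. apply (HX (Rmax r0 (d x y)) (Rmax_l _ _) x y Hx). apply Rmax_r.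
  - apply HA. apply finite_sub with (2 := HX2). intros y Hy H. apply Hempty. exists y. tauto.
Qed.

(** * Nested translates *)

(** A step of length at most [r] out of the corner would leave [P] from a frontier point outside
    [Q], or enter [Q] at a frontier point inside [P]. *)
Lemma corner_closed r P Q :
  (forall x, frontier P r x -> Q x) -> (forall x, frontier Q r x -> ~ P x) ->
  closed_at r (fun x => P x /\ ~ Q x).
Proof.
  intros HP HQ x y [HPx HQx] Hxy.
  assert (HPy : P y).
  { apply NNPP. intros H. apply HQx, HP. exists y. tauto. }
  split; [exact HPy|]. intros HQy.
  destruct (frontier_sym Q r x y Hxy ltac:(tauto)) as [_ H]. exact (HQ y H HPy).
Qed.

Lemma frontier_compl A r x : frontier (fun x => ~ A x) r x -> frontier A r x.
Proof. intros [y [Hxy Hn]]. exists y. tauto. Qed.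

(* The frontier [K] of [A] and its translates far away lie on one side of [A], because
   the frontier of [A] at the scale of the diameter of [K] is finite.  So one of the four
   corners cut out by [A] and its translate is closed at scale [r]; two of them are
   excluded by the choice of [r], and the other two are finite, hence empty. *)
Lemma far_translates_nested A r :
  almost_invariant A ->
  (forall X, closed_at r X -> (exists x, X x) -> ~ finite X) ->
  (forall X, closed_at r X -> ~ finite (fun x => ~ (A x <-> X x))) ->
  exists E, finite E /\ forall h, ~ E h -> finite (fun x => ~ (A x <-> A (mul h x))) ->
    ((forall x, A x -> A (mul h x)) \/ (forall x, A (mul h x) -> A x)) /\
    exists x, ~ (A x <-> A (mul h x)).
Proof.
  intros HA Hinf Hncl. pose (K := frontier A r).
  destruct (finite_diameter K (HA r)) as [s Hs].
  (* Avoiding the frontier at scale [s] keeps the moved copy of [K] on one side of [A]; avoiding [K]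
     makes [A] differ from its translate. *)
  pose (L := fun x => frontier A s x \/ K x).
  assert (HL : finite L) by (apply finite_union; apply HA).
  exists (fun h => exists x, K x /\ (L (mul h x) \/ L (mul (inv h) x))). split.
  { apply finite_bind; [apply HA|]. intros x _. apply finite_union.
    - apply (finite_preimage (fun h => mul h x)); [apply mulIr | exact HL].
    - apply (finite_preimage (fun h => mul (inv h) x)); [|exact HL].
      intros g h H. apply invI, (mulIr x), H. }
  intros h Hh Hfin.
  (* With empty frontier [A] itself would be closed at scale [r]. *)
  assert (HK : exists x, K x).
  { apply NNPP. intros Hn. apply (Hncl A).
    - intros x y Hx Hxy. apply NNPP. intros Hy. apply Hn. exists x, y. tauto.
    - exists nil. intros x Hx. tauto. }
  destruct HK as [x0 Hx0].
  assert (Hside : forall g x, (forall y, K y -> ~ L (mul g y)) -> K x ->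
    (A (mul g x) <-> A (mul g x0))).
  { intros g x Hgy Hx. apply NNPP. intros Hn. apply (Hgy x Hx). left. exists (mul g x0).
    rewrite Hl. auto. }
  assert (Hh1 : forall y, K y -> ~ L (mul h y)) by (intros y Hy HLy; eauto).
  assert (Hh2 : forall y, K y -> ~ L (mul (inv h) y)) by (intros y Hy HLy; eauto).
  pose (B := fun x => A (mul h x)).
  assert (HfB : forall x, frontier B r x -> (A x <-> A (mul (inv h) x0))).
  { intros x [y [Hxy Hn]]. rewrite <- (mulKV h x). apply (Hside (inv h) _ Hh2).
    exists (mul h y). rewrite Hl. auto. }
  assert (HfA : forall x, frontier A r x -> (B x <-> A (mul h x0)))
    by (intros x Hx; exact (Hside h x Hh1 Hx)).
  split.
  - destruct (classic (A (mul h x0))) as [H1 | H1], (classic (A (mul (inv h) x0))) as [H2 | H2].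
    + exfalso.
      (* The union of [A] and [B] would be closed at scale [r] and finitely close to [A]. *)
      apply (Hncl (fun x => ~ (~ A x /\ ~ B x))).
      * apply closed_at_compl, corner_closed.
        -- intros x Hx. apply frontier_compl in Hx. apply HfA in Hx. tauto.
        -- intros x Hx. apply HfB in Hx. tauto.
      * apply finite_sub with (2 := Hfin). unfold B. intros x Hx. tauto.
    + left. intros x Hx. apply NNPP. intros Hn.
      apply (Hinf (fun x => A x /\ ~ B x)).
      * apply corner_closed.
        -- intros y Hy. apply HfA in Hy. tauto.
        -- intros y Hy. apply HfB in Hy. tauto.
      * exists x. auto.
      * apply finite_sub with (2 := Hfin). unfold B. intros y Hy. tauto.
    + right. intros x Hx. apply NNPP. intros Hn.
      apply (Hinf (fun x => ~ A x /\ ~ ~ B x)).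
      * apply corner_closed.
        -- intros y Hy. apply frontier_compl in Hy. apply HfA in Hy. tauto.
        -- intros y Hy. apply frontier_compl in Hy. apply HfB in Hy. tauto.
      * exists x. auto.
      * apply finite_sub with (2 := Hfin). unfold B. intros y Hy. tauto.
    + exfalso.
      (* Here the same holds for the intersection of [A] and [B]. *)
      apply (Hncl (fun x => A x /\ ~ ~ B x)).
      * apply corner_closed.
        -- intros x Hx. apply HfA in Hx. tauto.
        -- intros x Hx. apply frontier_compl in Hx. apply HfB in Hx. tauto.
      * apply finite_sub with (2 := Hfin). unfold B. intros x Hx. tauto.
  - apply NNPP. intros Hn.
    assert (Heq : forall x, A x <-> A (mul h x)) by (intros x; apply NNPP; eauto).
    (* If [h] preserved [A], it would preserve the frontier [K], but it moves [x0] off [K]. *)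
    apply (Hh1 x0 Hx0). right. destruct Hx0 as [y0 [Hd0 Hn0]].
    exists (mul h y0). rewrite Hl, <- !Heq. auto.
Qed.

(** * Powers of a translation *)

Lemma iter_mul n g x : Nat.iter n (mul g) x = mul (Nat.iter n (mul g) e) x.
Proof.
  induction n as [|n IH]; simpl; [now rewrite (grp_idl _ _ _ _ Hg)|].
  now rewrite IH, (grp_assoc _ _ _ _ Hg).
Qed.

Lemma dist_iter n g x y : d (Nat.iter n (mul g) x) (Nat.iter n (mul g) y) = d x y.
Proof. rewrite (iter_mul n g x), (iter_mul n g y). apply Hl. Qed.

(** The group acts freely on itself, so a power of [g] with one fixed point is the identity. *)
Lemma iter_fixed_point n g x y : Nat.iter n (mul g) x = x -> Nat.iter n (mul g) y = y.
Proof.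
  intros H. rewrite iter_mul in H. rewrite iter_mul.
  rewrite <- (grp_idl _ _ _ _ Hg x) in H at 2. apply mulIr in H. rewrite H.
  apply (grp_idl _ _ _ _ Hg).
Qed.

Lemma iter_mul_inj g x :
  (forall n, Nat.iter (S n) (mul g) x <> x) ->
  forall y m n, Nat.iter m (mul g) y = Nat.iter n (mul g) y -> m = n.
Proof.
  intros Hx y.
  assert (H : forall m k, Nat.iter m (mul g) y <> Nat.iter (S (m + k)) (mul g) y).
  { induction m as [|m IH]; intros k Heq.
    - apply (Hx k), (iter_fixed_point _ _ y). symmetry. exact Heq.
    - apply (IH k), (mulI g). exact Heq. }
  intros m n Hmn. destruct (Nat.lt_trichotomy m n) as [Hlt | [Heq | Hlt]]; [exfalso | exact Heq | exfalso].
  - apply (H m (n - S m)%nat). rewrite Hmn. f_equal. lia.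
  - apply (H n (m - S n)%nat). rewrite <- Hmn. f_equal. lia.
Qed.

Lemma iter_cancel n g x : Nat.iter n (mul g) (Nat.iter n (mul (inv g)) x) = x.
Proof.
  revert x. induction n as [|n IH]; intros x; [reflexivity|].
  rewrite Nat.iter_succ_r. simpl. rewrite mulVK. apply IH.
Qed.

(* With [h = g^-1], the translates [h^n (A \ hA)], n in Z, cover [G]; so outside [A] every
   infinite set that [g] moves only finitely contains a tail of the [g]-orbit of one of the
   finitely many points of [A \ hA]. *)
Lemma at_most_one_other_end g A B C z :
  almost_invariant A -> almost_invariant B ->
  (forall x, A (mul g x) -> A x) -> A z -> ~ A (mul g z) ->
  finite (fun x => ~ (A x <-> A (mul g x))) ->
  finite (fun x => ~ (B x <-> B (mul g x))) ->
  finite (fun x => ~ (C x <-> C (mul g x))) ->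
  ~ finite B -> ~ finite C ->
  (forall x, ~ (A x /\ B x) /\ ~ (A x /\ C x) /\ ~ (B x /\ C x)) -> False.
Proof.
  intros HA HB Hmono HAz HnAz HfA HfB HfC HiB HiC Hdisj.
  pose (D := fun x => A x /\ ~ A (mul g x)).
  assert (HD : finite D) by (apply finite_sub with (2 := HfA); unfold D; tauto).
  (* Once outside [A], the forward orbit of [z] never returns; hence [g] has infinite order. *)
  assert (Hzn : forall n, ~ A (Nat.iter (S n) (mul g) z)).
  { induction n as [|n IH]; [exact HnAz|]. intros H. apply IH, Hmono. exact H. }
  assert (Hinj : forall y m n, Nat.iter m (mul g) y = Nat.iter n (mul g) y -> m = n).
  { apply (iter_mul_inj g z). intros n H. apply (Hzn n). rewrite H. exact HAz. }
  assert (Hinj' : forall y m n,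
    Nat.iter m (mul (inv g)) y = Nat.iter n (mul (inv g)) y -> m = n).
  { apply (iter_mul_inj (inv g) z). intros n H. apply (Hzn n).
    rewrite <- H, iter_cancel. exact HAz. }
  assert (Hback : forall n y, A y -> A (Nat.iter n (mul (inv g)) y)).
  { intros n y Hy. induction n as [|n IH]; [exact Hy|]. apply Hmono. simpl.
    rewrite mulVK. exact IH. }
  (* The backward orbit of [z] stays in [A], and that of [x] follows it at distance [d z x]. If it
     never met [A], the frontier of [A] at that scale would be infinite. *)
  assert (Hreach : forall x, exists n, A (Nat.iter n (mul (inv g)) x)).
  { intros x. apply NNPP. intros Hn.
    destruct (finite_escape _ (fun n => Nat.iter n (mul (inv g)) z) (Hinj' z) (HA (d z x)))
      as [N HN].
    apply (HN N (le_n N)). exists (Nat.iter N (mul (inv g)) x). rewrite dist_iter.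
    split; [lra|]. intros H. apply Hn. exists N. apply H, Hback, HAz. }
  (* On the way forward from [A] to a point outside, the orbit leaves [A] at a point of [D]. *)
  assert (Hcover : forall n x, A (Nat.iter n (mul (inv g)) x) ->
    A x \/ exists w m, D w /\ x = Nat.iter m (mul g) w).
  { induction n as [|n IH]; intros x Hx; [left; exact Hx|].
    rewrite Nat.iter_succ_r in Hx.
    destruct (classic (A x)) as [HAx | HAx]; [left; exact HAx | right].
    destruct (IH _ Hx) as [H | [w [m [Hw Heq]]]].
    - exists (mul (inv g) x), 1%nat. unfold D. simpl. rewrite mulVK. auto.
    - exists w, (S m). split; [exact Hw|]. simpl. rewrite <- Heq, mulVK. reflexivity. }
  (* Far along an orbit, membership in [X] is constant. If no orbit ended in [X], those from [D]
     would all be outside [X] from a common [N] on, and [X] would be finite. *)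
  assert (Hevent : forall X : G -> Prop, finite (fun x => ~ (X x <-> X (mul g x))) ->
    ~ finite X -> (forall x, ~ (A x /\ X x)) ->
    exists w N, forall n, (N <= n)%nat -> X (Nat.iter n (mul g) w)).
  { intros X HfX HiX HAX. apply NNPP. intros Hn. apply HiX.
    destruct (eventually_uniform D (fun w n => ~ X (Nat.iter n (mul g) w)) HD) as [N HN].
    - intros w _.
      destruct (finite_escape _ (fun n => Nat.iter n (mul g) w) (Hinj w) HfX) as [N HN].
      assert (Hconst : forall k,
        X (Nat.iter (N + k) (mul g) w) <-> X (Nat.iter N (mul g) w)).
      { induction k as [|k IH]; [now rewrite Nat.add_0_r|].
        rewrite <- IH, Nat.add_succ_r. specialize (HN (N + k)%nat ltac:(lia)).
        simpl in *. tauto. }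
      exists N. intros n Hn' HXn. apply Hn. exists w, N. intros k Hk.
      replace k with (N + (k - N))%nat by lia. apply Hconst, (Hconst (n - N)%nat).
      replace (N + (n - N))%nat with n by lia. exact HXn.
    - apply finite_sub with
        (fun x => exists w, D w /\ exists n, In n (seq 0 N) /\ Nat.iter n (mul g) w = x).
      + intros x Hx. destruct (Hreach x) as [n Hxn].
        destruct (Hcover n x Hxn) as [HAx | [w [m [Hw Heq]]]].
        * exfalso. exact (HAX x (conj HAx Hx)).
        * exists w. split; [exact Hw|]. exists m. split; [|symmetry; exact Heq].
          apply in_seq. destruct (Nat.le_gt_cases N m) as [HNm | HNm]; [|lia].
          exfalso. apply (HN w Hw m HNm). rewrite <- Heq. exact Hx.
      + apply finite_bind; [exact HD|]. intros w _.
        apply finite_bind; [exists (seq 0 N); auto|].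
        intros n _. exists (Nat.iter n (mul g) w :: nil). intros x ->. left. reflexivity. }
  destruct (Hevent B HfB HiB) as [w [N HwB]]; [intros x; apply Hdisj|].
  destruct (Hevent C HfC HiC) as [w' [N' HwC]]; [intros x; apply Hdisj|].
  (* The two tails run parallel at distance [d w w'], one in [B] and one in [C], and so give
     infinitely many frontier points of [B]. *)
  destruct (finite_escape _ (fun n => Nat.iter n (mul g) w) (Hinj w) (HB (d w w')))
    as [M HM].
  apply (HM (N + N' + M)%nat); [lia|]. exists (Nat.iter (N + N' + M) (mul g) w').
  rewrite dist_iter. split; [lra|]. intros H.
  apply (proj2 (proj2 (Hdisj (Nat.iter (N + N' + M) (mul g) w')))).
  split; [apply H, HwB | apply HwC]; lia.
Qed.

End Ends.

(** * Three ends among finitely many are impossible *)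

Theorem theorem5p10 (G : Type) (mul : G -> G -> G) (inv : G -> G) (e : G)
  (d : G -> G -> R) :
  is_group G mul inv e -> countable G ->
  is_metric d -> proper_metric d -> left_invariant mul d ->
  set_infinite (ends_set d) \/ set_card_le2 (ends_set d).
Proof.
  intros Hg _ Hd Hp Hl.
  destruct (classic (finite (ends_set d))) as [HE | HE]; [right | left; exact HE].
  intros a b c Ha Hb Hc. apply NNPP. intros Hn.
  destruct (three_ends_disjoint e d Hd Hp a b c Ha Hb Hc)
    as [A [B [C [HA [HB [HC [HiA [HiB [HiC Hdisj]]]]]]]]]; try tauto.
  assert (HG : ~ finite (fun _ : G => True)).
  { intros H. apply HiA. apply finite_sub with (2 := H). trivial. }
  assert (HcA : ~ finite (fun x => ~ A x)).
  { intros H. apply HiB. apply finite_sub with (2 := H). intros x Hx HAx.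
    apply (proj1 (Hdisj x)). tauto. }
  destruct (not_locally_finite e d Hd Hp mul inv Hg Hl HG HE) as [r0 Hr0].
  destruct (exists_scale_not_closed d Hd A r0 HiA HcA Hr0) as [r [Hr Hncl]].
  assert (Hinf : forall X, closed_at d r X -> (exists x, X x) -> ~ finite X).
  { intros X HX. apply Hr0. exact (closed_at_le d r0 r X Hr HX). }
  destruct (far_translates_nested e d Hd mul inv Hg Hl A r HA Hinf Hncl) as [E [HEf Hfar]].
  destruct (exists_fixing_ends e d mul inv Hg Hl E HG HE HEf) as [h [HEh Hfix]].
  assert (Hmove : forall X, almost_invariant d X -> finite (fun x => ~ (X x <-> X (mul h x)))).
  { intros X. exact (fixing_ends_moves_finite e d Hd Hp mul inv Hg Hl h X Hfix). }
  destruct (Hfar h HEh (Hmove A HA)) as [[Hnest | Hnest] [x Hx]].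
  (* Here [h] maps [A] into itself, so the roles are taken by [inv h] and by [mul h x], a point of
     [A] that [inv h] moves out of [A]. *)
  - apply (at_most_one_other_end e d mul inv Hg Hl (inv h) A B C (mul h x)); auto;
      try (apply (moves_finite_inv e mul inv Hg); auto).
    + intros y Hy. apply Hnest in Hy. now rewrite (mulVK e mul inv Hg) in Hy.
    + specialize (Hnest x). tauto.
    + rewrite (mulKV e mul inv Hg). specialize (Hnest x). tauto.
  - apply (at_most_one_other_end e d mul inv Hg Hl h A B C x); auto;
      specialize (Hnest x); tauto.
Qed.
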